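(* Let $\alpha\in(0,2]$. For every real $\lambda\le\frac{\alpha}{2}$, $$\left(|x|^2+\lambda|y|^2\right)^{\frac12}\le\left(\int_{\mathbb{T}}|x+\zeta y|^\alpha\,\mathrm{d}m(\zeta)\right)^{\frac1\alpha}$$ holds for all $x,y\in\mathbb{C}$ (for which $|x|^2+\lambda|y|^2\ge 0$, so that the left-hand side is defined; this is automatic when $\lambda\ge 0$). Moreover, $\frac{\alpha}{2}$ is the best (i.e. largest) real constant $\lambda$ with this property: for every real $\lambda>\frac{\alpha}{2}$ there exist $x,y\in\mathbb{C}$ for which the inequality fails.
   Context: $\mathbb{T}=\{\zeta\in\mathbb{C}:|\zeta|=1\}$ is the complex unit circle and $m$ is the Haar (normalized arc-length) measure on $\mathbb{T}$, with $m(\mathbb{T})=1$. *)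

(* Defs.v *)
From HB Require Import structures.
From mathcomp Require Import all_boot all_order all_algebra.
From mathcomp Require Import all_classical all_reals all_analysis.
From mathcomp Require Import complex.

Set Implicit Arguments.
Unset Strict Implicit.
Unset Printing Implicit Defensive.

Import Order.TTheory GRing.Theory Num.Theory.
Import numFieldNormedType.Exports.
Import ComplexField.Normc.

Local Open Scope classical_set_scope.
Local Open Scope ring_scope.
Local Open Scope complex_scope.

(* R[i] with its Borel sigma-algebra; R[i]^o carries the topology of the
   modulus. The modulus itself is taken in R, as normc : R[i] -> R, since the
   generic norm `|z| of R[i] takes its values in R[i]. *)
Definition borelC (R : realType) := g_sigma_algebraType (@open R[i]^o).

HB.instance Definition _ (R : realType) := Measurable.on (borelC R).

Definition unit_circle (R : realType) : set (borelC R) :=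
  [set z : R[i] | normc z = 1].

Definition cis (R : realType) (t : measurableTypeR R) : borelC R := cos t +i* sin t.

Lemma normc_cis (R : realType) (t : R) : normc (cis t) = 1.
Proof. by rewrite /= cos2Dsin2 sqrtr1. Qed.

Lemma normc_le (R : realType) (a b : R) : normc (a +i* b) <= `|a| + `|b|.
Proof.
rewrite /= -(@ger0_norm _ (`|a| + `|b|)) ?addr_ge0// -sqrtr_sqr ler_wsqrtr//.
rewrite sqrrD !real_normK ?num_real// lerD2r lerDl.
by rewrite mulrn_wge0 ?mulr_ge0.
Qed.

Lemma continuous_cis (R : realType) : continuous (@cis R : R -> R[i]^o).
Proof.
move=> t; apply/cvgrPdist_lt => -[e e'] /=.
rewrite ltcE /= => /andP[/eqP -> e0].
have e2 : 0 < e / 2 by rewrite divr_gt0.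
near=> s.
rewrite -[X in `|X|]/((cos t - cos s) +i* (sin t - sin s)).
rewrite -[X in X < _]/(normc ((cos t - cos s) +i* (sin t - sin s)))%:C.
rewrite ltcR (le_lt_trans (normc_le _ _))// [e]splitr ltrD//.
- near: s; move: (e / 2) e2; apply/(@cvgrPdist_lt R R^o).
  exact: continuous_cos.
- near: s; move: (e / 2) e2; apply/(@cvgrPdist_lt R R^o).
  exact: continuous_sin.
Unshelve. all: by end_near. Qed.

Lemma measurable_cis (R : realType) : measurable_fun setT (@cis R).
Proof.
apply: (@measurability _ _ (measurableTypeR R) (borelC R) _ _ (@open R[i]^o)) => // _ [U oU <-].
rewrite setTI; apply: measurable_realfun.open_measurable.
have /continuousP := @continuous_cis R; exact.
Qed.

HB.instance Definition _ (R : realType) :=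
  isMeasurableFun.Build _ _ (measurableTypeR R) (borelC R) (@cis R) (@measurable_cis R).

Lemma pi2_gt0 (R : realType) : 0 < 2 * pi :> R.
Proof. by rewrite mulr_gt0// pi_gt0. Qed.

(* The normalized arc length on the unit circle, as a Borel probability measure
   on the complex plane carried by the circle: the image of the uniform
   probability on `[0, 2 * pi]` under t |-> e^(it). *)
Definition haarT (R : realType) : probability (borelC R) R :=
  distribution (uniform_prob (@pi2_gt0 R)) (@cis R).

Lemma measurable_unit_circle (R : realType) : measurable (@unit_circle R).
Proof.
rewrite -[@unit_circle R]setCK; apply: measurableC; apply: sub_sigma_algebra.
have -> : @unit_circle R = (fun z : R[i]^o => `|z| : R[i]^o) @^-1` [set 1].
  apply/seteqP; split => -[a b]; rewrite /unit_circle /=; last by case.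
  by move=> e; congr Complex.
apply: closed_openC; apply: preimage_closed; first by move=> z _; exact: norm_continuous.
exact/accessible_closed_set1/hausdorff_accessible/norm_hausdorff.
Qed.

Lemma haarT_unit_circle (R : realType) : haarT R (@unit_circle R) = 1%E.
Proof.
rewrite -[RHS](@probability_setT _ _ _ (haarT R)).
rewrite /haarT /= /distribution /pushforward; congr (uniform_prob _ _).
by apply/seteqP; split => t //= _; exact: normc_cis.
Qed.

(* Main.v *)
Require Import Defs.
From mathcomp Require Import all_boot all_order all_algebra.
From mathcomp Require Import all_classical all_reals all_analysis.
From mathcomp Require Import measurable_realfun complex.
From mathcomp Require Import ring lra.
Import Order.TTheory GRing.Theory Num.Theory.
Import numFieldNormedType.Exports.
Import ComplexField.Normc.
Local Open Scope classical_set_scope.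
Local Open Scope ring_scope.

(** Put p = alpha / 2, so that 0 < p <= 1. The integral only depends on |x| and
|y|, is symmetric in them and homogeneous, and the inequality is hardest when
|x| >= |y|; so take x = 1 and |y| = r <= 1. As (1 + p r^2)^p <= 1 + p^2 r^2 by
Bernoulli's inequality, everything follows from

  mean of |1 + r z|^(2p) over |z| = 1  >=  1 + p^2 r^2,

which is Bessel's inequality for the first two Taylor coefficients 1 and p r of
(1 + r z)^p.

The proof of this mean inequality avoids complex powers. Let v = 1 + p r z be
the first order Taylor polynomial, so that |v|^2 has mean 1 + p^2 r^2, and write
|1 + r z|^(2p) = |v|^2 e^x with x = p log |1 + r z|^2 - log |v|^2. Then e^x is at
least 1 + x, and the mean of |v|^2 x is zero: |v|^2 only contains harmonics of
rank 0 and 1, so it sees only the constant and linear Taylor coefficients of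
2 p log (1 + r z) - 2 log (1 + p r z), which vanish. For r < 1 the logarithms
are uniformly approximated by their Taylor polynomials (ln_circ_approx), so the
only integrals ever computed are those of trigonometric polynomials
(has_mean_circ_affine, mean_circ_powR_ge). The case r = 1 follows by letting r
tend to 1 (mean_circ1_powR_ge), and general x and y by scaling and symmetry
(mean_powR_ge).

For optimality, x is O(r^2) because its linear terms cancel, so e^x <= 1 + x +
O(r^4) and the mean is at most 1 + p^2 r^2 + O(r^4) (mean_circ_powR_le), whereas
(1 + lambda r^2)^p = 1 + p lambda r^2 + O(r^4). If lambda > p the inequality
fails for x = 1 and y = r small. *)

(** * The squared modulus on a circle and its logarithm *)

(** The squared modulus |1 + s e^(iu)|^2. *)
Definition circ {R : realType} (s u : R) : R := 1 + s ^+ 2 + 2 * s * cos u.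

(** The real part of the degree N Taylor polynomial of 2 log (1 + z) at
z = s e^(iu). *)
Definition logpoly {R : realType} (N : nat) (s u : R) : R :=
  \sum_(k < N) 2 * (-1) ^+ k * s ^+ k.+1 / k.+1%:R * cos (k.+1%:R * u).

Lemma cos_mulSS {R : realType} (n : nat) (u : R) :
  2 * cos u * cos (n.+1%:R * u) = cos (n.+2%:R * u) + cos (n%:R * u).
Proof.
have -> : n.+2%:R * u = n.+1%:R * u + u by rewrite -[n.+2]addn1 natrD mulrDl mul1r.
have -> : n%:R * u = n.+1%:R * u - u by rewrite -[n.+1]addn1 natrD mulrDl mul1r addrK.
rewrite cosD cosB; ring.
Qed.

(** The s-derivative of the logarithm of circ s u is 2 (cos u + s) / circ s u;
this closed form of a geometric sum compares it with the derivative of its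
Taylor polynomial, with an explicit remainder of order s^N. It is the real
part of the sum of the (-s)^k e^(i(k+1)u), cleared of its denominator. *)
Lemma circ_geometric {R : realType} (N : nat) (s u : R) :
  circ s u * (\sum_(k < N) (- s) ^+ k * cos (k.+1%:R * u)) =
  cos u + s - (- s) ^+ N * (cos (N.+1%:R * u) + s * cos (N%:R * u)).
Proof.
elim: N => [|N IH].
  by rewrite big_ord0 mulr0 expr0 !mul1r mul0r cos0 mulr1 subrr.
rewrite big_ord_recr /= mulrDr IH /circ (exprS (- s)).
have -> : cos (N.+2%:R * u) = 2 * cos u * cos (N.+1%:R * u) - cos (N%:R * u).
  by rewrite cos_mulSS addrK.
ring.
Qed.

Lemma circ_ge {R : realType} (s u : R) : 0 <= s -> (1 - s) ^+ 2 <= circ s u.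
Proof. by move=> s0; rewrite /circ; have := cos_geN1 u; nra. Qed.

Lemma circ_ge0 {R : realType} (s u : R) : 0 <= s -> 0 <= circ s u.
Proof. by move=> s0; apply: le_trans (circ_ge _ _ s0); exact: sqr_ge0. Qed.

Lemma circ_gt0 {R : realType} (s u : R) : 0 <= s < 1 -> 0 < circ s u.
Proof.
move=> /andP[s0 s1]; apply: lt_le_trans (circ_ge _ _ s0).
by rewrite exprn_gt0// subr_gt0.
Qed.

Lemma is_derive_ln_circ {R : realType} (s u : R) : 0 <= s < 1 ->
  is_derive s 1 (fun s => ln (circ s u)) (2 * (cos u + s) / circ s u).
Proof.
move=> s01; have Q0 := circ_gt0 s u s01.
have dQ : is_derive s 1 (circ ^~ u) (2 * (cos u + s)).
  rewrite /circ; apply: is_derive_eq.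
  rewrite /GRing.scale /=; ring.
rewrite mulrC.
exact: (@is_derive1_comp _ _ (circ ^~ u) s _ _ (is_derive1_ln Q0) dQ).
Qed.

Lemma is_derive_logpoly {R : realType} (N : nat) (s u : R) :
  is_derive s 1 (fun s => logpoly N s u)
    (2 * \sum_(k < N) (- s) ^+ k * cos (k.+1%:R * u)).
Proof.
rewrite /logpoly mulr_sumr.
have -> : (fun s => \sum_(k < N) 2 * (-1) ^+ k * s ^+ k.+1 / k.+1%:R * cos (k.+1%:R * u)) =
   \sum_(k < N) (fun s => 2 * (-1) ^+ k * s ^+ k.+1 / k.+1%:R * cos (k.+1%:R * u)).
  by apply/funext => x; rewrite fct_sumE.
apply: is_derive_sum => k.
have k0 : k.+1%:R != 0 :> R by rewrite pnatr_eq0.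
have -> : 2 * ((- s) ^+ k * cos (k.+1%:R * u)) =
    (2 * (-1) ^+ k / k.+1%:R * cos (k.+1%:R * u)) * (k.+1%:R * s ^+ k).
  by rewrite (exprNn s k); field; rewrite addrC natr1.
set K := (2 * (-1) ^+ k / k.+1%:R * cos (k.+1%:R * u)).
rewrite (_ : (fun _ => _) = K *: (@id R ^+ k.+1)); last first.
  by apply/funext => x; rewrite /K /GRing.scale /= /GRing.scale /= fctE; ring.
apply: is_derive_eq.
by rewrite /GRing.scale /= mulr1.
Qed.

(** Both functions of s vanish at 0 and their derivatives differ by the remainder
of the geometric sum divided by circ s u, which is at least (1 - s)^2; the mean
value theorem on [0, s] turns this into a bound that is uniform in u. Uniformity
is what allows integration of the logarithm without any limit theorem. *)
Lemma ln_circ_approx {R : realType} (N : nat) (s u : R) : 0 <= s < 1 ->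
  `|ln (circ s u) - logpoly N s u| <= 4 * s ^+ N.+1 / (1 - s) ^+ 2.
Proof.
move=> /andP[s0 s1].
pose g (x : R) := ln (circ x u) - logpoly N x u.
pose dg (x : R) := 2 * (cos u + x) / circ x u -
  2 * \sum_(k < N) (- x) ^+ k * cos (k.+1%:R * u).
have dgE (x : R) : 0 <= x <= s -> is_derive x 1 g (dg x).
  move=> /andP[x0 xs].
  have dQ := is_derive_ln_circ x u (ssrbool.introT andP (conj x0 (le_lt_trans xs s1))).
  have dL := is_derive_logpoly N x u.
  exact: (is_deriveB dQ dL).
have g0 : g 0 = 0.
  rewrite /g /circ /logpoly big1 => [|k _].
    by rewrite expr0n /= !(mulr0, mul0r, addr0) ln1 subr0.
  by rewrite expr0n /= !(mulr0, mul0r).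
have cg : {within `[0, s], continuous g}.
  apply: derivable_within_continuous => x; rewrite in_itv /= => xs.
  exact: (@ex_derive _ _ _ _ _ _ _ (dgE x xs)).
have dgoo (x : R) : x \in `]0, s[ -> is_derive x 1 g (dg x).
  by rewrite in_itv /= => /andP[x0 xs]; apply: dgE; rewrite (ltW x0) (ltW xs).
have [c cs] := MVT_segment s0 dgoo cg.
rewrite -[ln _ - _]/(g s) g0 !subr0 => ->.
move: cs; rewrite in_itv /= => /andP[c0 cs].
have c1 : 0 <= c < 1 by rewrite c0 (le_lt_trans cs).
have Q0 := circ_gt0 c u c1.
have -> : dg c = 2 * ((- c) ^+ N * (cos (N.+1%:R * u) + c * cos (N%:R * u))) / circ c u.
  have := circ_geometric N c u.
  rewrite /dg; move: (\sum_(_ < _) _) => S E.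
  apply: (mulIf (lt0r_neq0 Q0)); rewrite mulrBl !mulfVK ?gt_eqF//.
  by rewrite -(mulrA 2 S) (mulrC S) E; ring.
have s20 : 0 < (1 - s) ^+ 2 by rewrite exprn_gt0// subr_gt0.
rewrite normrM (ger0_norm s0).
rewrite (_ : 4 * _ / _ = 4 * s ^+ N / (1 - s) ^+ 2 * s); last by rewrite exprSr; ring.
rewrite ler_wpM2r//.
rewrite normrM normfV (gtr0_norm Q0) ler_pM ?invr_ge0 ?(ltW Q0)//.
  rewrite normrM (ger0_norm (ler0n _ 2)) normrM normrX normrN (ger0_norm c0).
  have -> : 4 * s ^+ N = 2 * (s ^+ N * 2) by ring.
  rewrite ler_pM2l// ler_pM//; first exact: exprn_ge0.
    by rewrite lerXn2r ?nnegrE.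
  rewrite (le_trans (ler_normD _ _))// (_ : 2 = 1 + 1)// lerD ?cos_max//.
  by rewrite normrM (ger0_norm c0) mulr_ile1 ?cos_max ?(ltW (le_lt_trans cs s1)).
rewrite lef_pV2 ?posrE// (le_trans _ (circ_ge c u c0))//.
by rewrite lerXn2r ?nnegrE ?subr_ge0 ?(ltW s1) ?(ltW (le_lt_trans cs s1))// lerD2l lerN2.
Qed.

(** * Mean values over a period *)

Notation unif := (uniform_prob (@pi2_gt0 _)).

(** Integrability is bundled with the value, so that the mean value of a
trigonometric polynomial is computed by closure rules alone. *)
Definition has_mean {R : realType} (f : R -> R) (m : R) : Prop :=
  unif.-integrable setT (EFin \o f) /\ (\int[unif]_t (f t)%:E = m%:E)%E.

Lemma unif_setT {R : realType} : uniform_prob (@pi2_gt0 R) setT = 1%E.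
Proof. exact: (@probability_setT _ _ _ (uniform_prob (@pi2_gt0 R))). Qed.

Lemma has_mean_cst {R : realType} (c : R) : has_mean (cst c) c.
Proof.
split; first exact: finite_measure_integrable_cst.
rewrite -[LHS]/(\int[unif]_t cst c%:E t)%E.
by rewrite integral_cst//= unif_setT mule1.
Qed.

Lemma has_meanD {R : realType} (f g : R -> R) (m n : R) :
  has_mean f m -> has_mean g n -> has_mean (fun t => f t + g t) (m + n).
Proof.
move=> [If fm] [Ig gn]; split; first exact: (integrableD measurableT If Ig).
by under eq_integral do rewrite EFinD; rewrite integralD// fm gn.
Qed.

Lemma has_meanZ {R : realType} (c : R) (f : R -> R) (m : R) :
  has_mean f m -> has_mean (fun t => c * f t) (c * m).
Proof.
move=> [If fm]; split; first exact: (integrableZl measurableT c If).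
by under eq_integral do rewrite EFinM; rewrite integralZl// fm.
Qed.

Lemma has_mean_sum {R : realType} (N : nat) (f : nat -> R -> R) (m : nat -> R) :
  (forall k, has_mean (f k) (m k)) ->
  has_mean (fun t => \sum_(k < N) f k t) (\sum_(k < N) m k).
Proof.
move=> fm; elim: N => [|N IH].
  rewrite big_ord0 (_ : (fun _ => _) = cst 0); first exact: has_mean_cst.
  by apply/funext => t; rewrite big_ord0.
rewrite big_ord_recr /= (_ : (fun _ => _) = (fun t => \sum_(k < N) f k t + f N t)).
  exact: has_meanD.
by apply/funext => t; rewrite big_ord_recr.
Qed.

Lemma le_has_mean {R : realType} (f g : R -> R) (m n : R) :
  has_mean f m -> has_mean g n -> (forall t, f t <= g t) -> m <= n.
Proof.
move=> [If fm] [Ig gn] fg; rewrite -lee_fin -fm -gn.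
by apply: le_integral => // t _; rewrite lee_fin.
Qed.

Lemma bounded_has_mean {R : realType} (f : R -> R) (M : R) :
  measurable_fun setT f -> (forall t, `|f t| <= M) -> exists m, has_mean f m.
Proof.
move=> mf fM.
have If : unif.-integrable setT (EFin \o f).
  apply: measurable_bounded_integrable => //.
    by rewrite /= unif_setT ltry.
  exists M; split; first exact: num_real.
  by move=> x Mx t _; exact: le_trans (fM t) (ltW Mx).
exists (fine (\int[unif]_t (f t)%:E)%E); split => //.
by rewrite fineK// integrable_fin_num.
Qed.

(** The transfer from the uniform law to the Lebesgue integral applies to
nonnegative functions, so the fundamental theorem of calculus is applied to
1 + cos instead of cos; a primitive of it increases by the length of the
period. *)
Lemma has_mean_cos {R : realType} (n : nat) (theta : R) :
  has_mean (fun t => cos (n.+1%:R * (t + theta))) 0.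
Proof.
pose c (t : R) := cos (n.+1%:R * (t + theta)).
have n0 : n.+1%:R != 0 :> R by rewrite pnatr_eq0.
pose F (t : R) := t + n.+1%:R^-1 * sin (n.+1%:R * (t + theta)).
have dF (t : R) : is_derive t 1 F (1 + c t).
  rewrite /F; apply: is_derive_eq; rewrite /GRing.scale /= /c.
  by rewrite !(mulr1, addr0) mulrC mulfK.
have cc : continuous c.
  move=> t; apply: continuous_comp; last exact: continuous_cos.
  apply: cvgM; first exact: cvg_cst.
  by apply: cvgD; [exact: cvg_id|exact: cvg_cst].
have mc : measurable_fun setT c by exact: continuous_measurable_fun.
have [|m cm] := bounded_has_mean c 1 mc; first by move=> t; exact: cos_max.
(* Boundedness gives some mean m; that it is 0 is read off from 1 + cos. *)
suff : 1 + m = 1 by move/eqP; rewrite -subr_eq0 addrC addKr => /eqP <-.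
have [_ E] := has_meanD _ _ _ _ (has_mean_cst 1) cm.
apply: EFin_inj; rewrite -E integral_uniform; last 2 first.
- apply/measurable_EFinP; apply: measurable_funD => //.
- by move=> t; rewrite lee_fin addrC -lerBlDr sub0r cos_geN1.
have cFt t : {for t, continuous F}.
  by apply: differentiable_continuous; apply/derivable1_diffP; exact: ex_derive.
rewrite (@continuous_FTC2 _ _ F) ?pi2_gt0//; first last.
- by move=> t _; rewrite derive1E; apply: derive_val.
- split.
  + by move=> t _; exact: ex_derive.
  + exact/cvg_at_right_filter/cFt.
  + exact/cvg_at_left_filter/cFt.
- apply: continuous_subspaceT => t; apply: cvgD; [exact: cvg_cst|exact: cc].
rewrite -EFinB -EFinM subr0 /F.
have sin_per k (x : R) : sin (x + k%:R * (2 * pi)) = sin x.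
  elim: k => [|k IH]; first by rewrite mul0r addr0.
  by rewrite -natr1 mulrDl mul1r addrA [X in _ + X]mulr_natl sinD2pi IH.
rewrite !add0r [n.+1%:R * (2 * pi + theta)]mulrDr [_ + n.+1%:R * theta]addrC sin_per.
by rewrite addrK mulVf// gt_eqF// pi2_gt0.
Qed.

Lemma has_mean_harmonic {R : realType} (n : nat) (theta : R) :
  has_mean (fun t => cos (n%:R * (t + theta))) (n == 0)%:R.
Proof.
case: n => [|n]; last exact: has_mean_cos.
rewrite (_ : (fun _ => _) = cst 1); first exact: has_mean_cst.
by apply/funext => t; rewrite mul0r cos0.
Qed.

Lemma has_mean_circ {R : realType} (s theta : R) :
  has_mean (fun t => circ s (t + theta)) (1 + s ^+ 2).
Proof.
have := has_meanD _ _ _ _ (has_mean_cst (1 + s ^+ 2))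
  (has_meanZ (2 * s) _ _ (has_mean_harmonic 1 theta)).
rewrite mulr0 addr0; congr has_mean; apply/funext => t.
by rewrite mul1r.
Qed.

(** By cos_mulSS the product of circ s with the harmonic of rank k + 1 only
involves the harmonics of rank k, k + 1 and k + 2. Hence only k = 0
contributes: the mean sees nothing but the linear coefficient of the logarithm. *)
Lemma has_mean_circ_logpoly {R : realType} (N : nat) (s r theta : R) :
  has_mean (fun t => circ s (t + theta) * logpoly N.+1 r (t + theta)) (2 * s * r).
Proof.
pose a (k : nat) : R := 2 * (-1) ^+ k * r ^+ k.+1 / k.+1%:R.
pose h k t := a k * ((1 + s ^+ 2) * cos (k.+1%:R * (t + theta)) +
    (s * cos (k.+2%:R * (t + theta)) + s * cos (k%:R * (t + theta)))).
have hm k : has_mean (h k) (a k * ((1 + s ^+ 2) * 0 + (s * 0 + s * (k == 0)%:R))).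
  apply: has_meanZ; apply: has_meanD; first exact/has_meanZ/has_mean_harmonic.
  by apply: has_meanD; exact/has_meanZ/has_mean_harmonic.
have := has_mean_sum N.+1 _ _ hm.
rewrite big_ord_recl big1 => [|k _]; last by rewrite /= !(mulr0, addr0).
have -> : a 0%N * ((1 + s ^+ 2) * 0 + (s * 0 + s * (0%N == 0%N)%:R)) + 0 = 2 * s * r.
  by rewrite /a /= expr0 expr1 divr1; ring.
congr has_mean; apply/funext => t.
rewrite /logpoly mulr_sumr; apply: eq_bigr => k _.
by rewrite /h -[s * _ + s * _]mulrDr -cos_mulSS /circ /a; ring.
Qed.

(** The crucial cancellation: against the weight circ (p r), the truncations
of p log |1 + r z|^2 and log |1 + p r z|^2 have the same mean, because the two
functions have the same linear Taylor coefficient p r. *)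
Lemma has_mean_circ_affine {R : realType} (N : nat) (r p c theta : R) :
  has_mean (fun t => circ (p * r) (t + theta) *
    (1 + (p * logpoly N.+1 r (t + theta) - logpoly N.+1 (p * r) (t + theta)) + c))
    ((1 + (p * r) ^+ 2) * (1 + c)).
Proof.
have m1 := has_meanZ (1 + c) _ _ (has_mean_circ (p * r) theta).
have m2 := has_meanZ p _ _ (has_mean_circ_logpoly N (p * r) r theta).
have m3 := has_meanZ (-1) _ _ (has_mean_circ_logpoly N (p * r) (p * r) theta).
have := has_meanD _ _ _ _ m1 (has_meanD _ _ _ _ m2 m3).
have -> : (1 + c) * (1 + (p * r) ^+ 2) +
    (p * (2 * (p * r) * r) + -1 * (2 * (p * r) * (p * r))) =
    (1 + (p * r) ^+ 2) * (1 + c) by ring.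
by congr has_mean; apply/funext => t; ring.
Qed.

(** * The mean of |1 + r z|^(2p) for r < 1 *)

Lemma ln_circ_quotient {R : realType} (N : nat) (r p u : R) :
  0 <= r < 1 -> 0 <= p <= 1 ->
  `|(p * ln (circ r u) - ln (circ (p * r) u)) -
    (p * logpoly N r u - logpoly N (p * r) u)| <= 8 * r ^+ N.+1 / (1 - r) ^+ 2.
Proof.
move=> /andP[r0 r1] /andP[p0 p1].
have pr0 : 0 <= p * r by rewrite mulr_ge0.
have prr : p * r <= r by rewrite ler_piMl.
have pr1 := le_lt_trans prr r1.
have E1 := ln_circ_approx N r u (ssrbool.introT andP (conj r0 r1)).
have E2 := ln_circ_approx N (p * r) u (ssrbool.introT andP (conj pr0 pr1)).
have E3 : 4 * (p * r) ^+ N.+1 / (1 - p * r) ^+ 2 <= 4 * r ^+ N.+1 / (1 - r) ^+ 2.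
  apply: ler_pM; rewrite ?invr_ge0 ?sqr_ge0 ?mulr_ge0 ?exprn_ge0//.
    by rewrite ler_pM2l// lerXn2r ?nnegrE.
  rewrite lef_pV2 ?posrE ?exprn_gt0 ?subr_gt0//.
  by rewrite lerXn2r ?nnegrE ?subr_ge0 ?(ltW r1) ?(ltW pr1)// lerD2l lerN2.
rewrite (_ : _ - _ = p * (ln (circ r u) - logpoly N r u) -
  (ln (circ (p * r) u) - logpoly N (p * r) u)); last by ring.
rewrite (le_trans (ler_normB _ _))// (_ : 8 * _ / _ = 4 * r ^+ N.+1 / (1 - r) ^+ 2
   + 4 * r ^+ N.+1 / (1 - r) ^+ 2); last by ring.
rewrite lerD//; last exact: le_trans E2 E3.
by rewrite normrM (ger0_norm p0) (le_trans _ E1)// ler_piMl.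
Qed.

(** (1 + r z)^p is compared with its first order Taylor polynomial 1 + p r z, whose
squared modulus has mean 1 + (p r)^2. *)
Lemma circ_powRE {R : realType} (r p u : R) : 0 <= r < 1 -> 0 <= p <= 1 ->
  circ r u `^ p =
  circ (p * r) u * expR (p * ln (circ r u) - ln (circ (p * r) u)).
Proof.
move=> r01 /andP[p0 p1]; have Q0 := circ_gt0 r u r01.
have /andP[r0 r1] := r01.
have Q1 : 0 < circ (p * r) u.
  by apply: circ_gt0; rewrite mulr_ge0//= (le_lt_trans _ r1)// ler_piMl.
rewrite /powR gt_eqF// expRD expRN lnK ?posrE// mulrCA mulfV ?mulr1// gt_eqF//.
Qed.

Lemma cvg_tail {R : realType} (r : R) : 0 <= r < 1 ->
  (8 * r ^+ N.+2 / (1 - r) ^+ 2) @[N --> \oo] --> (0 : R).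
Proof.
move=> /andP[r0 r1].
rewrite (_ : (fun _ => _) = (fun N => (8 * r ^+ 2 / (1 - r) ^+ 2) * r ^+ N)); last first.
  by apply/funext => N; rewrite !exprS expr0; ring.
rewrite -[X in _ --> X](mulr0 (8 * r ^+ 2 / (1 - r) ^+ 2)).
by apply: cvgM; [exact: cvg_cst|apply: cvg_expr; rewrite ger0_norm].
Qed.

(** Applying e^x >= 1 + x to the exponent of circ_powRE leaves a function whose
mean is known exactly by has_mean_circ_affine, up to a Taylor remainder which
is removed by letting N tend to infinity. *)
Lemma mean_circ_powR_ge {R : realType} (r p theta m : R) :
  0 <= r < 1 -> 0 <= p <= 1 ->
  has_mean (fun t => circ r (t + theta) `^ p) m -> 1 + (p * r) ^+ 2 <= m.
Proof.
move=> r01 p01 mm.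
pose e (N : nat) := 8 * r ^+ N.+2 / (1 - r) ^+ 2.
have bound N : (1 + (p * r) ^+ 2) * (1 - e N) <= m.
  apply: le_has_mean (has_mean_circ_affine N r p (- e N) theta) mm _ => t.
  have /andP[r0 _] := r01; have /andP[p0 _] := p01.
  rewrite circ_powRE// ler_wpM2l ?circ_ge0 ?mulr_ge0//.
  apply: le_trans (expR_ge1Dx _).
  have := ln_circ_quotient N.+1 r p (t + theta) r01 p01.
  by rewrite ler_norml -/(e N) => /andP[+ _]; lra.
have cv : (1 + (p * r) ^+ 2) * (1 - e N) @[N --> \oo] --> (1 + (p * r) ^+ 2) * (1 - 0).
  apply: cvgM; first exact: cvg_cst.
  by apply: cvgB; [exact: cvg_cst|exact: cvg_tail].
rewrite subr0 mulr1 in cv.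
rewrite -(cvg_lim _ cv)//; apply: limr_le; first by apply/cvg_ex; eexists; exact: cv.
by near=> N; exact: bound.
Unshelve. all: by end_near. Qed.

(** This is e^x <= 1 / (1 - x), that is e^(-x) >= 1 - x, with the inverse
expanded to second order. *)
Lemma expR_le_quad {R : realType} (x : R) : x <= 2^-1 -> expR x <= 1 + x + 2 * x ^+ 2.
Proof.
move=> x2.
have x1 : 0 < 1 - x by lra.
have le1 : expR x <= (1 - x)^-1.
  rewrite -[expR x]invrK lef_pV2 ?posrE ?invr_gt0 ?expR_gt0// -expRN.
  exact: expR_ge1Dx.
apply: le_trans le1 _; rewrite -[_^-1]mul1r ler_pdivrMr//.
by have := sqr_ge0 x; nra.
Qed.

(** The lower bound is sharp to second order: the exponent x of circ_powRE is
O(r^2), since its first order terms cancel, so that e^x <= 1 + x + O(r^4). *)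
Lemma mean_circ_powR_le {R : realType} (r p theta m : R) :
  0 <= r <= 8^-1 -> 0 <= p <= 1 ->
  has_mean (fun t => circ r (t + theta) `^ p) m ->
  m <= (1 + (p * r) ^+ 2) * (1 + 512 * r ^+ 4).
Proof.
move=> /andP[r0 r8] p01 mm.
have r01 : 0 <= r < 1 by rewrite r0 /=; lra.
have /andP[p0 p1] := p01.
pose e (N : nat) := 8 * r ^+ N.+2 / (1 - r) ^+ 2.
have e0 : 8 * r ^+ 2 / (1 - r) ^+ 2 <= 16 * r ^+ 2.
  rewrite ler_pdivrMr; last by rewrite exprn_gt0//; lra.
  have : 2^-1 <= (1 - r) ^+ 2 by nra.
  by have := sqr_ge0 r; nra.
have bound N : m <= (1 + (p * r) ^+ 2) * (1 + (512 * r ^+ 4 + e N)).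
  apply: le_has_mean mm (has_mean_circ_affine N r p (512 * r ^+ 4 + e N) theta) _ => t.
  rewrite circ_powRE// ler_wpM2l ?circ_ge0 ?mulr_ge0//.
  set x := _ - _.
  (* At N = 1 the polynomial part p * (2 * r * cos u) - 2 * (p * r) * cos u
     vanishes, so x itself is bounded by the remainder. *)
  have x16 : `|x| <= 16 * r ^+ 2.
    apply: le_trans e0; have := ln_circ_quotient 1 r p (t + theta) r01 p01.
    rewrite -/x /logpoly !big_ord1 /= (_ : p * _ - _ = 0) ?subr0//.
    by rewrite !expr1; ring.
  have x2 : x ^+ 2 <= 256 * r ^+ 4.
    rewrite -real_normK ?num_real// (_ : 256 * _ = (16 * r ^+ 2) ^+ 2); last by ring.
    by rewrite lerXn2r ?nnegrE ?mulr_ge0 ?sqr_ge0.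
  have xh : x <= 2^-1 by rewrite (le_trans (ler_norm x))// (le_trans x16)//; nra.
  apply: le_trans (expR_le_quad x xh) _.
  have := ln_circ_quotient N.+1 r p (t + theta) r01 p01.
  by rewrite -/x ler_norml -/(e N) => /andP[_ +]; lra.
have cv : (1 + (p * r) ^+ 2) * (1 + (512 * r ^+ 4 + e N)) @[N --> \oo] -->
    (1 + (p * r) ^+ 2) * (1 + (512 * r ^+ 4 + 0)).
  apply: cvgM; first exact: cvg_cst.
  apply: cvgD; first exact: cvg_cst.
  by apply: cvgD; [exact: cvg_cst|exact: cvg_tail].
rewrite addr0 in cv.
rewrite -(cvg_lim _ cv)//; apply: limr_ge; first by apply/cvg_ex; eexists; exact: cv.
by near=> N; exact: bound.
Unshelve. all: by end_near. Qed.

(** * The boundary case r = 1 *)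

(** Dividing by (x + y)^p reduces this to t <= t^p for t = x / (x + y) and
t = y / (x + y), which add up to 1. *)
Lemma powR_subadditive {R : realType} (x y p : R) : 0 <= x -> 0 <= y -> 0 <= p <= 1 ->
  (x + y) `^ p <= x `^ p + y `^ p.
Proof.
move=> x0 y0 /andP[p0 p1].
have [s0|s0] := eqVneq (x + y) 0.
  have -> : x = 0 by lra.
  by rewrite add0r lerDr powR_ge0.
have s_gt0 : 0 < x + y by rewrite lt_def s0 addr_ge0.
have part z : 0 <= z -> z <= x + y -> z / (x + y) * (x + y) `^ p <= z `^ p.
  move=> z0 zs.
  have z1 : 0 <= z / (x + y) by rewrite divr_ge0// ltW.
  rewrite -{2}[z](divfK s0) powRM// ?(ltW s_gt0)// ler_wpM2r ?powR_ge0//.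
  move: z1; rewrite le_eqVlt => /orP[/eqP <-|z1]; first exact: powR_ge0.
  by rewrite ger1_powR// z1 ler_pdivrMr// mul1r.
have -> : (x + y) `^ p = x / (x + y) * (x + y) `^ p + y / (x + y) * (x + y) `^ p.
  by rewrite -mulrDl -mulrDl mulfV// mul1r.
by rewrite lerD// part// ?lerDl ?lerDr.
Qed.

(** The base is a^2 + b^2 + 2 a b cos, which lies between (a - b)^2 and
(a + b)^2: this gives the sign and the bound that integrability requires. *)
Lemma powR_has_mean {R : realType} (a b p theta : R) :
  0 <= a -> 0 <= b -> 0 <= p -> exists m,
  has_mean (fun t => (a ^+ 2 + b ^+ 2 + 2 * a * b * cos (t + theta)) `^ p) m.
Proof.
move=> a0 b0 p0; apply: (bounded_has_mean _ (((a + b) ^+ 2) `^ p)).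
  apply: (measurableT_comp (f := (@powR R)^~ p)) => //.
  apply: continuous_measurable_fun => t.
  apply: cvgD; first exact: cvg_cst.
  apply: cvgM; first exact: cvg_cst.
  apply: continuous_comp; last exact: continuous_cos.
  by apply: cvgD; [exact: cvg_id|exact: cvg_cst].
move=> t; rewrite ger0_norm ?powR_ge0//.
have ab0 : 0 <= a * b by rewrite mulr_ge0.
have hN : 0 <= a * b * (1 + cos (t + theta)).
  by rewrite mulr_ge0// -lerBlDl sub0r cos_geN1.
have h1 : 0 <= a * b * (1 - cos (t + theta)) by rewrite mulr_ge0// subr_ge0 cos_le1.
have := sqr_ge0 (a - b) => ab.
by rewrite ge0_ler_powR ?nnegrE ?sqr_ge0//; lra.
Qed.

(** The logarithm of circ 1 is unbounded, so the case r = 1 is obtained from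
r = 1 - e: pointwise circ (1 - e) <= circ 1 + e^2, and subadditivity of the
power p makes the error e^(2p) uniform. *)
Lemma mean_circ1_powR_ge {R : realType} (p theta m : R) : 0 < p <= 1 ->
  has_mean (fun t => circ 1 (t + theta) `^ p) m -> 1 + p ^+ 2 <= m.
Proof.
move=> /andP[p0 p1] mm.
have p01 : 0 <= p <= 1 by rewrite (ltW p0).
have bound (e : R) : 0 < e <= 1 -> 1 + (p * (1 - e)) ^+ 2 - e `^ (2 * p) <= m.
  move=> /andP[e0 e1].
  have s01 : 0 <= 1 - e < 1 by apply/andP; split; lra.
  have /andP[s0 _] := s01.
  have [m' mm'] : exists m', has_mean (fun t => circ (1 - e) (t + theta) `^ p) m'.
    have [m' mm'] := powR_has_mean 1 (1 - e) p theta ler01 s0 (ltW p0).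
    exists m'; move: mm'; congr has_mean; apply/funext => t.
    by rewrite /circ expr1n mulr1.
  have h1 := mean_circ_powR_ge _ _ _ _ s01 p01 mm'.
  rewrite lerBlDr; apply: le_trans h1 _.
  apply: le_has_mean mm' (has_meanD _ _ _ _ mm (has_mean_cst (e `^ (2 * p)))) _ => t.
  rewrite powRrM powR_mulrn ?(ltW e0)//=.
  apply: le_trans (powR_subadditive _ _ _ (circ_ge0 1 (t + theta) ler01) (sqr_ge0 e) p01).
  rewrite ge0_ler_powR ?nnegrE
    ?(addr_ge0 (circ_ge0 1 (t + theta) ler01) (sqr_ge0 e)) ?circ_ge0 ?(ltW p0)//.
  rewrite -subr_ge0 [leRHS](_ : _ = 2 * e * (1 + cos (t + theta))).
    have c0 : 0 <= 1 + cos (t + theta) by have := cos_geN1 (t + theta); lra.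
    by rewrite !mulr_ge0 ?(ltW e0).
  by rewrite /circ; ring.
have cv : 1 + (p * (1 - e)) ^+ 2 - e `^ (2 * p) @[e --> (0 : R)^'+] -->
    1 + (p * (1 - 0)) ^+ 2 - 0.
  apply: cvgB; last by apply: powR_cvg0; rewrite mulr_gt0.
  apply: cvg_at_right_filter.
  apply: cvgD; first exact: cvg_cst.
  have h : p * (1 - e) @[e --> (0 : R)] --> p * (1 - 0).
    by apply: cvgM; [exact: cvg_cst|apply: cvgB; [exact: cvg_cst|exact: cvg_id]].
  exact: (cvgM h h).
rewrite !subr0 mulr1 in cv.
rewrite -(cvg_lim _ cv)//; apply: limr_le; first by apply/cvg_ex; eexists; exact: cv.
near=> e; apply: bound; apply/andP; split; near: e.
- exact: nbhs_right_gt.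
- exact: nbhs_right_le.
Unshelve. all: by end_near. Qed.

(** * Arbitrary moduli *)

(** For p < 1, Young's inequality for (1 + x)^p and 1 with exponents 1 / p and
1 / (1 - p). *)
Lemma powR_bernoulli {R : realType} (x p : R) : 0 <= x -> 0 < p <= 1 ->
  (1 + x) `^ p <= 1 + p * x.
Proof.
move=> x0 /andP[p0]; rewrite le_eqVlt => /orP[/eqP ->|p1].
  by rewrite powRr1 ?mul1r// addr_ge0.
have y0 : 0 <= 1 + x by rewrite addr_ge0.
have q0 : 0 < 1 - p by rewrite subr_gt0.
have := @conjugate_powR R ((1 + x) `^ p) 1 p^-1 (1 - p)^-1 (powR_ge0 _ _) ler01.
rewrite !invr_gt0 => /(_ p0 q0); rewrite !invrK addrC subrK => /(_ erefl).
rewrite mulr1 powR1 -powRrM mulfV ?gt_eqF// powRr1//.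
by lra.
Qed.

(** By homogeneity a = 1 and b = r <= 1; then Bernoulli's inequality gives
(1 + p r^2)^p <= 1 + (p r)^2, which the mean dominates. *)
Lemma mean_powR_ge_ordered {R : realType} (a b p theta m : R) :
  0 <= b <= a -> 0 < p <= 1 ->
  has_mean (fun t => (a ^+ 2 + b ^+ 2 + 2 * a * b * cos (t + theta)) `^ p) m ->
  (a ^+ 2 + p * b ^+ 2) `^ p <= m.
Proof.
move=> /andP[b0 ba] /andP[p0 p1] mm.
have [a0|a0] := eqVneq a 0.
  have -> : b = 0 by lra.
  rewrite a0 expr0n /= mulr0 addr0 powR0 ?gt_eqF//.
  by apply: le_has_mean (has_mean_cst 0) mm _ => t; exact: powR_ge0.
have a_gt0 : 0 < a by rewrite lt_def a0 (le_trans b0).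
pose r := b / a.
have r0 : 0 <= r by rewrite divr_ge0// ltW.
have r1 : r <= 1 by rewrite ler_pdivrMr// mul1r.
have bE : b = r * a by rewrite divfK.
pose A := (a ^+ 2) `^ p.
have A0 : 0 < A by rewrite powR_gt0// exprn_gt0.
have mm' : has_mean (fun t => circ r (t + theta) `^ p) (A^-1 * m).
  have := has_meanZ A^-1 _ _ mm; congr has_mean; apply/funext => t.
  rewrite (_ : a ^+ 2 + _ + _ = a ^+ 2 * circ r (t + theta)).
    by rewrite powRM ?sqr_ge0 ?circ_ge0// mulrA mulVf ?mul1r ?gt_eqF.
  by rewrite bE /circ; ring.
have main : 1 + (p * r) ^+ 2 <= A^-1 * m.
  move: r1; rewrite le_eqVlt => /orP[/eqP r1|r1].
    rewrite r1 in mm' *; rewrite mulr1.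
    by apply: mean_circ1_powR_ge mm'; rewrite p0.
  by apply: mean_circ_powR_ge mm'; rewrite ?r0 ?r1 ?p1 ?(ltW p0).
have pr2 : 0 <= p * r ^+ 2 by apply: mulr_ge0 (ltW p0) (sqr_ge0 r).
have -> : a ^+ 2 + p * b ^+ 2 = a ^+ 2 * (1 + p * r ^+ 2) by rewrite bE; ring.
rewrite powRM ?sqr_ge0//; last by rewrite addr_ge0.
rewrite -/A -ler_pdivlMl//; apply: le_trans main.
apply: le_trans (powR_bernoulli _ _ pr2 _) _; first by rewrite p0.
by rewrite lerD2l [leLHS](_ : _ = (p * r) ^+ 2)//; ring.
Qed.

(** The mean is symmetric in a and b, while a^2 + p b^2 <= b^2 + p a^2 when
a <= b because p <= 1: the case b <= a is the worst one. *)
Lemma mean_powR_ge {R : realType} (a b p theta m : R) :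
  0 <= a -> 0 <= b -> 0 < p <= 1 ->
  has_mean (fun t => (a ^+ 2 + b ^+ 2 + 2 * a * b * cos (t + theta)) `^ p) m ->
  (a ^+ 2 + p * b ^+ 2) `^ p <= m.
Proof.
move=> a0 b0 p01 mm; have /andP[p0 p1] := p01.
have [ba|/ltW ab] := leP b a.
  by apply: mean_powR_ge_ordered mm; rewrite ?b0.
have mm' : has_mean (fun t => (b ^+ 2 + a ^+ 2 + 2 * b * a * cos (t + theta)) `^ p) m.
  by move: mm; congr has_mean; apply/funext => t; congr (_ `^ _); ring.
apply: le_trans (mean_powR_ge_ordered _ _ _ _ _ _ p01 mm'); last by rewrite a0.
rewrite ge0_ler_powR ?nnegrE ?addr_ge0 ?mulr_ge0 ?sqr_ge0 ?(ltW p0)//.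
have : a ^+ 2 <= b ^+ 2 by rewrite lerXn2r ?nnegrE.
by nra.
Qed.

(** * The Haar measure of the circle *)

Lemma polar {R : realType} (c d : R) :
  exists theta, c = Num.sqrt (c ^+ 2 + d ^+ 2) * cos theta /\
                d = Num.sqrt (c ^+ 2 + d ^+ 2) * sin theta.
Proof.
have n0 : 0 <= c ^+ 2 + d ^+ 2 by rewrite addr_ge0 ?sqr_ge0.
set rho := Num.sqrt _.
have rho2 : rho ^+ 2 = c ^+ 2 + d ^+ 2 by rewrite sqr_sqrtr.
have [r0|r0] := eqVneq rho 0.
  exists 0; move: rho2; rewrite r0 expr0n /= => /esym/eqP.
  rewrite paddr_eq0 ?sqr_ge0// !sqrf_eq0 => /andP[/eqP -> /eqP ->].
  by rewrite !mul0r.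
have rho0 : 0 < rho by rewrite lt_def r0 sqrtr_ge0.
have cb : -1 <= c / rho <= 1.
  rewrite -ler_norml normrM normfV (gtr0_norm rho0) ler_pdivrMr// mul1r.
  by rewrite -sqrtr_sqr ler_wsqrtr// lerDl sqr_ge0.
have cE : rho * cos (acos (c / rho)) = c.
  by rewrite acosK ?in_itv// (mulrC rho) divfK.
have sE : rho * sin (acos (c / rho)) = `|d|.
  rewrite sin_acos// -(sqrtr_sqr d) -{1}(ger0_norm (ltW rho0)) -(sqrtr_sqr rho).
  rewrite -sqrtrM ?sqr_ge0//; congr Num.sqrt.
  by rewrite mulrBr mulr1 expr_div_n mulrC divfK ?sqrf_eq0// rho2 addrC addKr.
have [d0|d0] := leP 0 d.
  by exists (acos (c / rho)); rewrite cE sE ger0_norm.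
by exists (- acos (c / rho)); rewrite cosN sinN cE mulrN sE ltr0_norm// opprK.
Qed.

Lemma sqr_normc {R : rcfType} (a b : R) : normc (Complex a b) ^+ 2 = a ^+ 2 + b ^+ 2.
Proof. by rewrite /= sqr_sqrtr// addr_ge0 ?sqr_ge0. Qed.

Lemma normc_nneg {R : rcfType} (z : R[i]) : 0 <= normc z.
Proof. by case: z => a b; exact: sqrtr_ge0. Qed.

(** The cross term is 2 Re (conj x * y * e^(it)), and theta is an argument of
conj x * y. Mean values of harmonics do not depend on theta, so no rotation
invariance of the measure has to be invoked. *)
Lemma normc_rotate {R : realType} (x y : R[i]) : exists theta, forall t : R,
  normc (x + (cis t : R[i]) * y) ^+ 2 =
  normc x ^+ 2 + normc y ^+ 2 + 2 * normc x * normc y * cos (t + theta).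
Proof.
case: x y => [a b] [c d].
(* (a * c + b * d, a * d - b * c) is the product of the conjugate of the first
   complex number with the second. *)
have [theta [ucos vsin]] := polar (a * c + b * d) (a * d - b * c).
exists theta => t.
have -> : 2 * normc (Complex a b) * normc (Complex c d) * cos (t + theta) =
    2 * (cos t * (a * c + b * d) - sin t * (a * d - b * c)).
  rewrite [in RHS]ucos [in X in _ - X]vsin cosD.
  rewrite -(mulrA 2); have -> : normc (Complex a b) * normc (Complex c d) =
      Num.sqrt ((a * c + b * d) ^+ 2 + (a * d - b * c) ^+ 2).
    rewrite /= -sqrtrM ?addr_ge0 ?sqr_ge0//; congr Num.sqrt; ring.
  ring.
rewrite sqr_normc [normc (Complex a b) ^+ 2]sqr_normc [normc (Complex c d) ^+ 2]sqr_normc.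
have cs : sin t ^+ 2 = 1 - cos t ^+ 2 by rewrite -(cos2Dsin2 t) addrAC subrr add0r.
rewrite (_ : c ^+ 2 + d ^+ 2 = (cos t ^+ 2 + sin t ^+ 2) * (c ^+ 2 + d ^+ 2)); last first.
  by rewrite cos2Dsin2 mul1r.
ring.
Qed.

Lemma normc_dist {R : rcfType} (z w : R[i]) : `|normc z - normc w| <= normc (z - w).
Proof.
rewrite ler_norml lerBlDr lerNl opprB lerBlDr; apply/andP; split.
  by have := le_normcD (- (z - w)) z; rewrite normcN opprB subrK.
by have := le_normcD (z - w) w; rewrite subrK.
Qed.

Lemma continuous_normc_affine {R : realType} (x y : R[i]) :
  continuous (fun z : R[i]^o => normc (x + (z : R[i]) * y) : R).
Proof.
move=> z; have Fz : Filter (nbhs (z : R[i]^o)) by exact: nbhs_filter.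
apply/(@cvgrPdist_lt _ _ _ _ Fz) => e e0.
have y1 : 0 < normc y + 1 by rewrite ltr_wpDl ?normc_nneg.
have d0 : 0 < (e / (normc y + 1))%:C%C by rewrite ltcR divr_gt0.
have zd := @cvgr_dist_lt _ _ _ _ Fz (@id R[i]^o) z cvg_id _ d0.
near=> w.
have zw : normc ((z : R[i]) - w) < e / (normc y + 1).
  rewrite -ltcR -[X in X < _]/(`|(z : R[i]^o) - w|).
  by near: w; exact: zd.
apply: le_lt_trans (normc_dist _ _) _.
rewrite opprD addrACA subrr add0r -mulrBl normcM.
move: zw; rewrite ltr_pdivlMr// => zw; apply: le_lt_trans zw.
by rewrite ler_wpM2l ?normc_nneg// lerDl.
Unshelve. all: by end_near. Qed.

Lemma measurable_normc_affine {R : realType} (x y : R[i]) :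
  measurable_fun setT (fun z : borelC R => normc (x + (z : R[i]) * y)).
Proof.
apply: (measurability _ (RGenOpens.measurableE R)) => // _ [U [a [b ->]] <-].
rewrite setTI; apply: sub_sigma_algebra.
by have /continuousP := continuous_normc_affine x y; apply; exact: interval_open.
Qed.

Lemma haarT_integral {R : realType} (alpha : R) (x y : R[i]) :
  (\int[haarT R]_(zeta in @unit_circle R)
      (normc (x + (zeta : R[i]) * y) `^ alpha)%:E)%E =
  (\int[unif]_t (normc (x + (cis t : R[i]) * y) `^ alpha)%:E)%E.
Proof.
rewrite /haarT /distribution ge0_integral_pushforward //=.
- rewrite (_ : _ @^-1` _ = setT)//.
  by apply/seteqP; split => t //= _; exact: normc_cis.
- exact: measurable_unit_circle.
- apply: measurable_funTS; apply/measurable_EFinP.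
  apply: (measurableT_comp (f := (@powR R)^~ alpha)) => //.
  exact: measurable_normc_affine.
- by move=> z _; rewrite lee_fin powR_ge0.
Qed.

Lemma haarT_mean {R : realType} (alpha : R) (x y : R[i]) : 0 <= alpha ->
  exists theta m,
    has_mean (fun t => (normc x ^+ 2 + normc y ^+ 2 +
      2 * normc x * normc y * cos (t + theta)) `^ (alpha / 2)) m /\
    (\int[haarT R]_(zeta in @unit_circle R)
      (normc (x + (zeta : R[i]) * y) `^ alpha)%:E = m%:E)%E.
Proof.
move=> alpha0; have [theta xyE] := normc_rotate x y.
have [m mm] := powR_has_mean (normc x) (normc y) (alpha / 2) theta
  (normc_nneg x) (normc_nneg y) (divr_ge0 alpha0 (ler0n R 2)).
exists theta, m; split => //.
rewrite haarT_integral; case: mm => _ <-; apply: eq_integral => t _.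
rewrite -xyE -powR_mulrn ?normc_nneg// -powRrM mulrCA divff ?mulr1//.
Qed.

(** * Sharpness and conclusion *)

(** Moves the exponent to the other side: both parts of the theorem compare
(|x|^2 + lambda |y|^2)^(alpha/2) with the mean itself. *)
Lemma sqrt_le_root {R : realType} (z m alpha : R) : 0 < alpha -> 0 <= z -> 0 <= m ->
  (Num.sqrt z <= m `^ (1 / alpha)) = (z `^ (alpha / 2) <= m).
Proof.
move=> alpha0 z0 m0.
have -> : Num.sqrt z = (z `^ (alpha / 2)) `^ (1 / alpha).
  rewrite -powRrM (_ : alpha / 2 * (1 / alpha) = 2^-1) ?powR12_sqrt//.
  by field; rewrite gt_eqF.
have i0 : 0 < 1 / alpha by rewrite divr_gt0.
apply/idP/idP => [|le].
  by apply: contraTT; rewrite -!ltNge => lt; rewrite gt0_ltr_powR ?nnegrE ?powR_ge0.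
by rewrite ge0_ler_powR ?nnegrE ?powR_ge0 ?(ltW i0).
Qed.

(** The inequality ln (1 + t) <= t at t = - x / (1 + x), for which
1 + t = 1 / (1 + x). *)
Lemma ln1D_ge {R : realType} (x : R) : 0 <= x -> x / (1 + x) <= ln (1 + x).
Proof.
move=> x0; have x1 : 0 < 1 + x by lra.
have h : -1 < - (x / (1 + x)).
  by rewrite ltrN2 ltr_pdivrMr// mul1r; lra.
have := le_ln1Dx h.
rewrite (_ : 1 + _ = (1 + x)^-1); last by field; lra.
by rewrite lnV ?posrE// lerN2.
Qed.

Lemma powR_ge_first_order {R : realType} (x p : R) : 0 <= x -> 0 <= p ->
  1 + p * (x / (1 + x)) <= (1 + x) `^ p.
Proof.
move=> x0 p0; rewrite /powR gt_eqF; last by lra.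
by rewrite (le_trans _ (expR_ge1Dx _))// lerD2l ler_wpM2l// ln1D_ge.
Qed.

(** Expanding in r^2, the left side is 1 + p^2 r^2 + O(r^4) and the right side
1 + p lambda r^2 + O(r^4), so any small enough r separates them when
p < lambda. *)
Lemma exists_small_radius {R : realType} (p lambda : R) : 0 < p <= 1 -> p < lambda ->
  exists2 r : R, 0 <= r <= 8^-1 &
    (1 + (p * r) ^+ 2) * (1 + 512 * r ^+ 4) < (1 + lambda * r ^+ 2) `^ p.
Proof.
move=> /andP[p0 p1] pl.
have l0 : 0 < lambda := lt_trans p0 pl.
(* K bounds the coefficient of w in the product
   (p ^+ 2 + 1024 * w) * (1 + lambda * w) when w <= 1 and p <= 1, so r * K, hence
   r ^+ 2 * K, must be smaller than the gap p * (lambda - p). *)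
pose K := 1024 + 1025 * lambda.
have K0 : 0 < K by rewrite /K; lra.
pose r := p * (lambda - p) / (2 * K).
have rK : r * K = p * (lambda - p) / 2 by rewrite /r; field; lra.
have d0 : 0 < p * (lambda - p) by rewrite mulr_gt0// subr_gt0.
have r0 : 0 < r by rewrite /r divr_gt0// mulr_gt0.
have r8 : r <= 8^-1.
  rewrite /r ler_pdivrMr ?mulr_gt0//.
  have : p * (lambda - p) <= lambda by nra.
  by rewrite /K; lra.
exists r; first by rewrite (ltW r0).
have w0 : 0 < r ^+ 2 by rewrite exprn_gt0.
have wr : r ^+ 2 <= r by rewrite expr2; nra.
apply: lt_le_trans (powR_ge_first_order _ _ _ (ltW p0)); last by rewrite mulr_ge0 ?ltW.
have -> : r ^+ 4 = r ^+ 2 * r ^+ 2 by rewrite -exprD.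
rewrite exprMn.
have wK : r ^+ 2 * K < p * (lambda - p).
  have : r ^+ 2 * K <= r * K by rewrite ler_wpM2r// ltW.
  by rewrite rK; lra.
move: (r ^+ 2) w0 wr wK => w w0 wr wK.
have w1 : w <= 1 by lra.
have D0 : 0 < 1 + lambda * w by rewrite addr_gt0// mulr_gt0.
have p2 : p ^+ 2 <= 1 by rewrite expr2; nra.
have p20 : 0 <= p ^+ 2 by exact: sqr_ge0.
have step : (1 + p ^+ 2 * w) * (1 + 512 * (w * w)) <= 1 + w * (p ^+ 2 + 1024 * w).
  have : p ^+ 2 * w <= 1 by nra.
  have : 0 <= w * w by nra.
  by nra.
(* It remains to compare coefficients of w = r ^+ 2:
   (p ^+ 2 + 1024 * w) * (1 + lambda * w) < p * lambda. *)
apply: le_lt_trans step _; rewrite ltrD2l.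
rewrite (_ : p * _ = w * (p * lambda / (1 + lambda * w))); last by field; lra.
rewrite ltr_pM2l// ltr_pdivlMr//.
have lw : 0 <= lambda * w by rewrite mulr_ge0 ?ltW.
have : p ^+ 2 * (lambda * w) <= lambda * w by rewrite ler_piMl.
have : w * (lambda * w) <= lambda * w by rewrite ler_piMl.
by move: wK; rewrite /K; lra.
Qed.

Theorem theorem1p1 (R : realType) (alpha : R) (halpha : 0 < alpha <= 2) :
  (forall lambda : R, lambda <= alpha / 2 ->
     forall x y : R[i], 0 <= normc x ^+ 2 + lambda * normc y ^+ 2 ->
       ((Num.sqrt (normc x ^+ 2 + lambda * normc y ^+ 2))%:E <=
        (\int[haarT R]_(zeta in @unit_circle R)
            (normc (x + (zeta : R[i]) * y) `^ alpha)%:E) `^ (1 / alpha))%E) /\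
  (forall lambda : R, alpha / 2 < lambda ->
     exists x y : R[i],
       ~ ((Num.sqrt (normc x ^+ 2 + lambda * normc y ^+ 2))%:E <=
          (\int[haarT R]_(zeta in @unit_circle R)
              (normc (x + (zeta : R[i]) * y) `^ alpha)%:E) `^ (1 / alpha))%E).
Proof.
have /andP[alpha0 alpha2] := halpha.
have p01 : 0 < alpha / 2 <= 1 by apply/andP; split; lra.
have /andP[p0 p1] := p01.
split=> lambda hl.
  move=> x y z0; have [theta [m [mm ->]]] := haarT_mean alpha x y (ltW alpha0).
  have m0 : 0 <= m.
    by apply: le_has_mean (has_mean_cst 0) mm _ => t; exact: powR_ge0.
  rewrite poweR_EFin lee_fin sqrt_le_root//.
  apply: le_trans (mean_powR_ge _ _ _ _ _ (normc_nneg x) (normc_nneg y) p01 mm).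
  have le : normc x ^+ 2 + lambda * normc y ^+ 2 <=
      normc x ^+ 2 + alpha / 2 * normc y ^+ 2 by rewrite lerD2l ler_wpM2r ?sqr_ge0.
  by rewrite ge0_ler_powR ?nnegrE ?(ltW p0)// (le_trans z0).
have p01w : 0 <= alpha / 2 <= 1 by rewrite p1 ltW.
have [r r08 rlt] := exists_small_radius _ _ p01 hl.
exists (Complex 1 0), (Complex r 0).
have /andP[r0 _] := r08.
have n1 : normc (Complex 1 0) = 1 :> R by rewrite /= expr1n expr0n addr0 sqrtr1.
have nr : normc (Complex r 0) = r by rewrite /= expr0n addr0 sqrtr_sqr ger0_norm.
have [theta [m [mm ->]]] := haarT_mean alpha (Complex 1 0) (Complex r 0) (ltW alpha0).
rewrite n1 nr in mm *.
have l0 : 0 <= lambda by lra.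
have m0 : 0 <= m.
  by apply: le_has_mean (has_mean_cst 0) mm _ => t; exact: powR_ge0.
rewrite poweR_EFin lee_fin sqrt_le_root ?addr_ge0 ?mulr_ge0 ?sqr_ge0//.
apply/negP; rewrite -ltNge expr1n; apply: le_lt_trans rlt.
have mm' : has_mean (fun t => circ r (t + theta) `^ (alpha / 2)) m.
  move: mm; congr has_mean; apply/funext => t.
  by rewrite /circ expr1n mulr1.
exact: mean_circ_powR_le r08 p01w mm'.
Qed.
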